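(* Consider the CPHD filter at time $k$: the predicted target process and the clutter process are i.i.d. cluster processes with cardinality distributions $\rho_{k|k-1}$ and $\rho_{\mathrm c}$ respectively, and targets are detected according to a Bernoulli process. The multi-object likelihood function of the CPHD filter for a given sensor state $s$ and a finite measurement set $Z$ is $$\ell_k^\sharp(s|Z)=\langle\tilde\Upsilon^0[\mu^\sharp_{k|k-1},Z],\rho_{k|k-1}\rangle$$ with $$\tilde\Upsilon^0[\mu^\sharp_{k|k-1},Z](n)=\sum_{j=0}^{\min(|Z|,n)}\frac{n!\,(|Z|-j)!}{(n-j)!}\,\rho_{\mathrm c}(|Z|-j)\,\mu_k^\phi(\mathcal X|s)^{n-j}\sum_{\substack{Z'\subseteq Z\\|Z'|=j}}\ \prod_{z\in Z'}\mu_k^z(\mathcal X)\prod_{z'\in (Z')^c}\mu_{\mathrm c,k}(z'),$$ where $(Z')^c=Z\setminus Z'$.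
   Context: **Spaces and model.** $\mathcal X$ is the target state space, $\mathcal Z$ the measurement space. All quantities are at time $k$ and conditional on the sensor state $s$. $p_{\mathrm d,k}(x|s)$ is the probability that a target in state $x$ is detected, and $\ell_k(z|x,s)$ is the single-target association likelihood of measurement $z$ with target state $x$. $\mu^\sharp_{k|k-1}(\cdot|s)$ is the predicted first-order moment (intensity) measure of the target process, $s^\sharp_{k|k-1}(\cdot|s)$ its spatial (probability) distribution on $\mathcal X$, and $\rho_{k|k-1}$ the predicted target cardinality distribution on $\mathbb N=\{0,1,2,\dots\}$. $\mu_{\mathrm c,k}(\cdot)$ is the clutter intensity on $\mathcal Z$, $s_{\mathrm c}(\cdot|s)$ the spatial distribution (density) of the clutter, and $\rho_{\mathrm c}$ the clutter cardinality distribution. The missed detection and association terms are $$\mu_k^\phi(\mathcal X|s)=\int_{\mathcal X}(1-p_{\mathrm d,k}(x|s))\,\mu^\sharp_{k|k-1}(\mathrm dx|s),\qquad \mu_k^z(\mathcal X)=\int_{\mathcal X}p_{\mathrm d,k}(x|s)\,\ell_k(z|x,s)\,\mu^\sharp_{k|k-1}(\mathrm dx|s).$$ For functions on $\mathbb N$, $\langle f,g\rangle=\sum_{n\ge0}f(n)g(n)$. **I.i.d. cluster process.** An i.i.d. cluster process with cardinality distribution $\rho$ and spatial distribution $\sigma$ has a number of points distributed according to $\rho$ and, given this number, i.i.d. points with law $\sigma$; its probability generating functional (PGFL) is $\mathcal G(h)=\sum_{n\ge0}\rho(n)\big[\int h(x)\,\sigma(\mathrm dx)\big]^n$. **Multi-object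 likelihood.** The observation process (target-generated measurements together with clutter) has, conditionally on $s$, the PGFL $$G^\sharp_{\mathrm{obs}}(g|s)=\Big(\sum_{n\ge0}\rho_{\mathrm c}(n)\Big[\int g(z)s_{\mathrm c}(z|s)\,\mathrm dz\Big]^n\Big)\Big(\sum_{n\ge0}\rho_{k|k-1}(n)\Big[\int\Big(1-p_{\mathrm d,k}(x|s)+p_{\mathrm d,k}(x|s)\int g(z)\ell_k(z|x,s)\,\mathrm dz\Big)s^\sharp_{k|k-1}(\mathrm dx|s)\Big]^n\Big).$$ For $Z=\{z_1,\dots,z_m\}$, $\ell_k^\sharp(s|Z)$ is the $m$-th order chain derivative $\delta^mG^\sharp_{\mathrm{obs}}(g;\delta_{z_1},\dots,\delta_{z_m}|s)|_{g=0}$. Here $\delta G(h;\eta)=\lim_{n\to\infty}\varepsilon_n^{-1}\big(G(h+\varepsilon_n\eta_n)-G(h)\big)$, the limit being the same for all real sequences $\varepsilon_n\to0$ and all sequences of functions $\eta_n\to\eta$ pointwise, and a derivative in the direction of a Dirac delta $\delta_z$ means the Radon–Nikodym density at $z$ of the measure $B\mapsto\delta G(h;\mathbf 1_B)$.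
   Formalization: ρ(n), ρ_c(n) are divided by the n-th powers of the target and clutter intensity masses (the printed formula fails otherwise); chain derivatives use uniformly bounded measurable directions at |h|≤r<1; a.e. uniqueness of the density assumes a countably generated measurement space. *)

(* Defs.v *)
From HB Require Import structures.
From mathcomp Require Import all_boot all_order all_algebra finmap.
From mathcomp Require Import all_classical all_reals all_analysis.
Set Implicit Arguments.
Unset Strict Implicit.
Unset Printing Implicit Defensive.
Import Order.TTheory GRing.Theory Num.Theory.
Import numFieldNormedType.Exports.
Local Open Scope classical_set_scope.
Local Open Scope ring_scope.

Definition is_card_distr (R : realType) (rho : nat -> R) : Prop :=
  (forall n, 0 <= rho n) /\ (\sum_(0 <= n <oo) (rho n)%:E = 1)%E.

(* Possibly +oo. The intensity of an i.i.d. cluster process is its mean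
   cardinality times its spatial distribution. *)
Definition card_mean (R : realType) (rho : nat -> R) : \bar R :=
  (\sum_(0 <= n <oo) (n%:R * rho n)%:E)%E.

(* The PGFL of an i.i.d. cluster process is this power series evaluated at the
   integral of the test function against the spatial distribution. The sum
   converges for |t| <= 1. *)
Definition card_pgf (R : realType) (rho : nat -> R) (t : R) : R :=
  limn (series (fun n => rho n * t ^+ n)).

(* [lam] is the reference measure written dz. *)
Definition G_obs (R : realType) (dX dZ : measure_display)
    (X : measurableType dX) (Z : measurableType dZ) (S : Type)
    (lam : {sigma_finite_measure set Z -> \bar R})
    (pd : X -> S -> R) (ell : Z -> X -> S -> R) (sc : Z -> S -> R)
    (ssharp : S -> probability X R) (rho rho_c : nat -> R) (s : S)
    (g : Z -> R) : R :=
  card_pgf rho_c (\int[lam]_z (g z * sc z s)) *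
  card_pgf rho (\int[ssharp s]_x
    (1 - pd x s + pd x s * \int[lam]_z (g z * ell z x s))).

(* Measurable functions of supremum norm < 1: both power series in [G_obs] are
   differentiable along such functions, whereas on the boundary (for instance
   at the constant 1) a two-sided derivative need not exist. *)
Definition test_fun (R : realType) (dZ : measure_display)
    (Z : measurableType dZ) (h : Z -> R) : Prop :=
  measurable_fun setT h /\ exists2 r : R, r < 1 & forall z, `|h z| <= r.

(* delta G(h; eta) = d. The sequences of directions consist of uniformly bounded
   measurable functions: without a uniform bound, pointwise convergence does not
   give convergence of integrals, and already g |-> \int g(z) sc(z) dz would have
   no derivative for the Lebesgue measure. *)
Definition is_chain_derive (R : realType) (dZ : measure_display)
    (Z : measurableType dZ) (G : (Z -> R) -> R) (h eta : Z -> R) (d : R)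
    : Prop :=
  forall (eps : nat -> R) (etas : nat -> Z -> R) (M : R),
    (forall n, eps n != 0) -> (eps n @[n --> \oo] --> (0 : R)) ->
    (forall n, measurable_fun setT (etas n)) ->
    (forall n z, `|etas n z| <= M) ->
    (forall z, etas n z @[n --> \oo] --> eta z) ->
    (eps n)^-1 * (G (fun z => h z + eps n * etas n z) - G h) @[n --> \oo] --> d.

(* [f] is a version of z |-> delta G(h; delta_z), i.e. a Radon-Nikodym density
   with respect to [lam] of the (signed) measure B |-> delta G(h; 1_B). *)
Definition is_dirac_derive (R : realType) (dZ : measure_display)
    (Z : measurableType dZ) (lam : {sigma_finite_measure set Z -> \bar R})
    (G : (Z -> R) -> R) (h : Z -> R) (f : Z -> R) : Prop :=
  lam.-integrable setT (EFin \o f) /\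
  forall B : set Z, measurable B ->
    is_chain_derive G h (\1_B) (\int[lam]_(z in B) f z).

(* [D [:: z1; ...; zk] h], k <= m, are versions of the iterated derivatives
   delta^k G(h; delta_z1, ..., delta_zk), each one being obtained from the
   previous one by
   delta^k G(h; .., delta_zk) = delta (delta^(k-1) G(.; ..)) (h; delta_zk). *)
Definition is_iter_dirac_derive (R : realType) (dZ : measure_display)
    (Z : measurableType dZ) (lam : {sigma_finite_measure set Z -> \bar R})
    (G : (Z -> R) -> R) (m : nat) (D : seq Z -> (Z -> R) -> R) : Prop :=
  (forall h, test_fun h -> D [::] h = G h) /\
  (forall zs h, (size zs < m)%N -> test_fun h ->
     is_dirac_derive lam (D zs) h (fun z => D (rcons zs z) h)).

(* For almost every z1, for almost every z2, ..., for almost every zm,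
   P [:: z1; ...; zm]. *)
Fixpoint ae_seq (R : realType) (dZ : measure_display)
    (Z : measurableType dZ) (lam : {sigma_finite_measure set Z -> \bar R})
    (m : nat) (P : seq Z -> Prop) : Prop :=
  match m with
  | 0 => P [::]
  | m'.+1 => {ae lam, forall z, ae_seq lam m' (fun zs => P (z :: zs))}
  end.

Definition countably_generated (dZ : measure_display) (Z : measurableType dZ)
    : Prop :=
  exists C : nat -> set Z, (@measurable dZ Z) = <<s range C >>.

Definition missed_detection (R : realType) (dX : measure_display)
    (X : measurableType dX) (S : Type) (pd : X -> S -> R)
    (mu : S -> {finite_measure set X -> \bar R}) (s : S) : R :=
  \int[mu s]_x (1 - pd x s).

Definition association (R : realType) (dX dZ : measure_display)
    (X : measurableType dX) (Z : measurableType dZ) (S : Type)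
    (pd : X -> S -> R) (ell : Z -> X -> S -> R)
    (mu : S -> {finite_measure set X -> \bar R}) (s : S) (z : Z) : R :=
  \int[mu s]_x (pd x s * ell z x s).

Definition Upsilon0 (R : realType) (dX dZ : measure_display)
    (X : measurableType dX) (Z : measurableType dZ) (S : Type)
    (pd : X -> S -> R) (ell : Z -> X -> S -> R) (rho_c : nat -> R)
    (muc : Z -> R) (mu : S -> {finite_measure set X -> \bar R}) (s : S)
    (Zs : {fset Z}) (n : nat) : R :=
  \sum_(0 <= j < (minn #|` Zs| n).+1)
    n`!%:R * (#|` Zs| - j)`!%:R / (n - j)`!%:R * rho_c (#|` Zs| - j)%N *
    missed_detection pd mu s ^+ (n - j) *
    \sum_(Z' <- fpowerset Zs | #|` Z'| == j)
      (\prod_(z <- Z') association pd ell mu s z) *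
      (\prod_(z' <- (Zs `\` Z')%fset) muc z').

(* <f, g>; it is only used with nonnegative terms, so that the sum is always
   meaningful in [0, +oo]. *)
Definition inner (R : realType) (f g : nat -> R) : \bar R :=
  (\sum_(0 <= n <oo) (f n * g n)%:E)%E.

(* [Upsilon0] is written with the intensities of the target and clutter
   processes, whose total masses are the mean cardinalities. An intensity of mass
   M is M times the spatial distribution, so a product of n integrals (or
   densities) carries a spurious factor M ^ n, which has to be divided out for
   the likelihood to be a density of the observation process. Nothing changes
   when M = 1. *)
Definition mass_normalized (R : realType) (rho : nat -> R) (M : R) (n : nat)
    : R := rho n / M ^+ n.

(* Main.v *)
Require Import Defs.
From HB Require Import structures.
From mathcomp Require Import all_boot all_order all_algebra finmap.
From mathcomp Require Import all_classical all_reals all_analysis.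
From mathcomp Require Import measurable_realfun ring lra.
Set Implicit Arguments.
Unset Strict Implicit.
Unset Printing Implicit Defensive.
Import Order.TTheory GRing.Theory Num.Theory.
Import numFieldNormedType.Exports.
Local Open Scope classical_set_scope.
Local Open Scope ring_scope.

(** The observation functional factors as G(g) = C(c(g)) U(u(g)), where C and U
are the generating functions of the clutter and target cardinalities,
c(g) = \int g sc dlam, and, by Fubini, u(g) = q + \int g a dlam with
q = \int (1 - pd) dssharp and a(z) = \int pd(x) ell(z|x) ssharp(dx)
([target_pgfl_arg]). So G depends on g only through two affine functionals with
integrable densities. By the chain and product rules, differentiating the
product of the i-th derivative of C and the j-th derivative of U in the
direction 1_B gives \int_B sc times the product of orders (i + 1, j) plus
\int_B a times the product of orders (i, j + 1)
([chain_derive_pgf_prod]). Hence each Dirac derivative at z chooses whether z is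
clutter, with weight sc(z), or comes from a target, with weight a(z)
([split_sum], [cphd_deriv_dirac]), and after m of them the derivative is a sum
over the subsets of detected measurements ([split_sumE]).

At g = 0 the arguments are c = 0 and u = q. The k-th derivative of C at 0 is
k! rho_c(k), and the j-th derivative of U at q is the sum over n of
n! / (n - j)! rho(n) q^(n - j). Exchanging the sum over n with the sum over
subsets gives the inner product, since the total masses of the intensities
cancel ([mass_cancel], [cphd_deriv0E]).

Differentiability of the power series is guaranteed inside the unit disc only.
Test functions have norm < 1, so c(h) lies inside. So does u(h), unless q = 1: then no target
is ever detected, a vanishes identically, u is the constant 1, and every term
with a derivative of U carries a factor a(z) = 0 ([target_arg_lt1]).

A Dirac derivative is only determined almost everywhere, with an exceptional set
that depends on the point h, whereas differentiating once more needs the values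
at uncountably many h. When the sigma-algebra of Z is countably generated, it is
enough to follow a countable family of h that contains 0 and is stable under
small perturbations in the directions of a countable pi-system of generators:
those directions determine the density of the next derivative
([ae_eq_finite_cap], [iter_dirac_derive_ae_unique]). *)

(** * Power series of cardinality distributions *)

Section power_series.
Context {R : realType}.
Implicit Types (f rho : nat -> R) (x y : R).

Lemma cvg_pseries_bounded f y B x : (forall n, `|f n * y ^+ n| <= B) ->
  `|x| < y -> cvgn (pseries f x).
Proof.
move=> fB xy; have y0 : 0 < y by exact: le_lt_trans xy.
have B0 : 0 <= B by exact: le_trans (fB 0%N).
apply: normed_cvg.
apply: (@series_le_cvg _ _ (geometric B (`|x| / y))).
- by move=> n /=.
- by move=> n /=; rewrite mulr_ge0// exprn_ge0// divr_ge0// ltW.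
- move=> n /=; rewrite expr_div_n mulrA ler_pdivlMr ?exprn_gt0//.
  rewrite -[X in _ * X <= _]gtr0_norm ?exprn_gt0// -!normrM mulrAC -normrX.
  by rewrite normrM ler_wpM2r.
- apply: is_cvg_geometric_series.
  by rewrite ger0_norm ?divr_ge0 ?(ltW y0)// ltr_pdivrMr// mul1r.
Qed.

(** The geometric sum 1 + r + ... + r^n has n + 1 terms, each at least r^n, and is
at most 1 / (1 - r). *)
Lemma geometric_mul_bounded (r : R) n : 0 <= r -> r < 1 ->
  n.+1%:R * r ^+ n <= (1 - r)^-1.
Proof.
move=> r0 r1; rewrite -[_^-1]mul1r ler_pdivlMr ?subr_gt0//.
have le1 : n.+1%:R * r ^+ n <= \sum_(i < n.+1) r ^+ i.
  rewrite mulr_natl -[X in _ *+ X <= _]card_ord -sumr_const ler_sum// => i _.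
  by apply: ler_wiXn2l; rewrite ?(ltW r1)// -ltnS.
apply: le_trans (ler_wpM2r _ le1) _; first by rewrite subr_ge0 ltW.
have := subrX1 r n.+1; rewrite mulrC => e.
have -> : (\sum_(i < n.+1) r ^+ i) * (1 - r) = 1 - r ^+ n.+1.
  by rewrite -opprB mulrN -e opprB.
by rewrite gerBl exprn_ge0.
Qed.

(** The factor n + 1 that differentiation brings out is absorbed by shrinking the
radius: for |x| < y < w < 1 the terms f_n w^n are bounded, hence so are the terms
of the derived series at y, which therefore converges at x. *)
Lemma cvg_pseries_diffs f : (forall x, `|x| < 1 -> cvgn (pseries f x)) ->
  forall x, `|x| < 1 -> cvgn (pseries (pseries_diffs f) x).
Proof.
move=> fcv x x1.
have [xy y1] := midf_lt x1; set y := (_ / _) in xy y1.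
have [yw w1] := midf_lt y1; set w := (_ / _) in yw w1.
clearbody w y; have y0 : 0 < y by exact: le_lt_trans xy.
have w0 : 0 < w by exact: lt_trans yw.
have /fcv/cvg_series_bounded[B [Breal fB]] : `|w| < 1 by rewrite gtr0_norm.
have yw1 : y / w < 1 by rewrite ltr_pdivrMr// mul1r.
have yw0 : 0 <= y / w by rewrite divr_ge0 ?ltW.
apply: (@cvg_pseries_bounded _ y ((1 - y / w)^-1 * ((`|B| + 1) / w))) => // n.
have {}fB : `|f n.+1 * w ^+ n.+1| <= `|B| + 1.
  by apply: (fB (`|B| + 1)) => //; rewrite (le_lt_trans (ler_norm B))// ltrDl.
have -> : pseries_diffs f n * y ^+ n =
    n.+1%:R * (y / w) ^+ n * (f n.+1 * w ^+ n.+1 / w).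
  have wn : w ^+ n != 0 by rewrite expf_neq0// gt_eqF.
  rewrite /pseries_diffs expr_div_n exprS.
  by move: (w ^+ n) wn (y ^+ n) => a a0 b; field; rewrite a0 gt_eqF.
rewrite normrM; apply: ler_pM => //.
- by rewrite ger0_norm ?mulr_ge0 ?exprn_ge0// geometric_mul_bounded.
- by rewrite normrM normfV (gtr0_norm w0) ler_pM2r ?invr_gt0.
Qed.

(** Coefficients of the j-th derivative of the power series with coefficients f. *)
Definition deriv_coef f j := iter j (@pseries_diffs R) f.

Lemma cvg_pseries_deriv_coef f j : (forall x, `|x| < 1 -> cvgn (pseries f x)) ->
  forall x, `|x| < 1 -> cvgn (pseries (deriv_coef f j) x).
Proof. by move=> fcv; elim: j => // j; exact: cvg_pseries_diffs. Qed.

Lemma deriv_coefE f j n :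
  deriv_coef f j n = ((n + j) ^_ j)%:R * f (n + j)%N.
Proof.
elim: j n => [|j IH] n; first by rewrite ffactn0 mul1r addn0.
rewrite /deriv_coef iterS /pseries_diffs -/(deriv_coef f j) IH mulrA -natrM addSnnS.
by rewrite ffactnSr mulnC addnS -addSn addnK.
Qed.

Lemma is_derive_card_pgf f j x : (forall y, `|y| < 1 -> cvgn (pseries f y)) ->
  `|x| < 1 ->
  is_derive x 1 (card_pgf (deriv_coef f j))
    (card_pgf (deriv_coef f j.+1) x).
Proof.
move=> fcv x1; have [xy y1] := midf_lt x1; set y := (_ / _) in xy y1.
have y0 : 0 < y by exact: le_lt_trans xy.
have {}y1 : `|y| < 1 by rewrite gtr0_norm.
apply: (@pseries_snd_diffs _ _ y); last by rewrite (gtr0_norm y0).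
- exact: cvg_pseries_deriv_coef.
- exact: (@cvg_pseries_deriv_coef f j.+1).
- exact: (@cvg_pseries_deriv_coef f j.+2).
Qed.

Lemma card_pgf0 f : card_pgf f 0 = f 0%N.
Proof.
apply/cvg_lim => //; apply: cvg_near_cst; exists 1%N => //= n n1.
rewrite /series/= -(prednK n1) big_nat_recl//= expr0 mulr1 big1 ?addr0// => i _.
by rewrite exprS mul0r mulr0.
Qed.

Lemma card_distr_cvg rho : is_card_distr rho -> series rho n @[n --> \oo] --> (1 : R).
Proof.
move=> [rho0 rho1].
have : (\sum_(0 <= k < n) (rho k)%:E @[n --> \oo] --> 1)%E.
  by rewrite -rho1; apply: is_cvg_nneseries => n _ _; rewrite lee_fin.
rewrite (_ : (fun n => _) = EFin \o series rho).
  by move/fine_cvgP => [_ h]; exact: h.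
by apply/funext => n; rewrite /= sumEFin.
Qed.

Lemma card_distr_cvg_pseries rho x : is_card_distr rho -> `|x| < 1 ->
  cvgn (pseries rho x).
Proof.
move=> rhoP; have [rho0 _] := rhoP; have rhocv := card_distr_cvg rhoP.
apply: (@cvg_pseries_bounded _ 1 1) => n.
rewrite expr1n mulr1 ger0_norm//.
have nd : nondecreasing_seq (series rho).
  by apply/nondecreasing_seqP => k; rewrite seriesSr lerDl.
have := nondecreasing_cvgn_le nd (cvgP _ rhocv) n.+1.
rewrite (cvg_lim _ rhocv)// seriesSr; apply: le_trans.
by rewrite lerDr sumr_ge0.
Qed.

Lemma card_pgf1 rho : is_card_distr rho -> card_pgf rho 1 = 1.
Proof.
move=> rhoP; apply/cvg_lim => //.
rewrite (_ : (fun n => _) = rho); first exact: card_distr_cvg.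
by apply/funext => n; rewrite expr1n mulr1.
Qed.
End power_series.

(** * The chain derivative *)

Section chain_derivative.
Context {R : realType} {dZ : measure_display} {Z : measurableType dZ}.
Variable lam : {sigma_finite_measure set Z -> \bar R}.
Implicit Types (F G : (Z -> R) -> R) (g h eta w : Z -> R) (a b c d : R).

Definition bounded_measurable g :=
  measurable_fun setT g /\ exists M : R, forall z, `|g z| <= M.

Lemma cvg_eq_seq (u v : nat -> R) (l : R) :
  u n @[n --> \oo] --> l -> u =1 v -> v n @[n --> \oo] --> l.
Proof. by move=> + /funext <-. Qed.

Lemma test_fun_bounded h : test_fun h -> bounded_measurable h.
Proof. by move=> [mh [r _ hr]]; split=> //; exists r. Qed.

Lemma chain_derive_cst c h eta : is_chain_derive (fun=> c) h eta 0.
Proof.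
move=> eps etas M _ _ _ _ _.
by under eq_fun do rewrite subrr mulr0; exact: cvg_cst.
Qed.

Lemma chain_deriveD F G h eta a b : is_chain_derive F h eta a ->
  is_chain_derive G h eta b ->
  is_chain_derive (fun g => F g + G g) h eta (a + b).
Proof.
move=> dF dG eps etas M e0 ecv mE ME Ecv.
have dFc := dF eps etas M e0 ecv mE ME Ecv.
have dGc := dG eps etas M e0 ecv mE ME Ecv.
by apply: (cvg_eq_seq (cvgD dFc dGc)) => n /=; ring.
Qed.

Lemma chain_deriveZ c F h eta a : is_chain_derive F h eta a ->
  is_chain_derive (fun g => c * F g) h eta (c * a).
Proof.
move=> dF eps etas M e0 ecv mE ME Ecv.
have dFc := dF eps etas M e0 ecv mE ME Ecv.
by apply: (cvg_eq_seq (cvgM (cvg_cst c) dFc)) => n /=; ring.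
Qed.

(** The difference quotient converges and is multiplied by eps n, which tends to
0: this is the continuity that the product and chain rules need. *)
Lemma chain_derive_cvg F h eta a (eps : nat -> R) (etas : nat -> Z -> R) (M : R) :
  is_chain_derive F h eta a ->
  (forall n, eps n != 0) -> (eps n @[n --> \oo] --> (0 : R)) ->
  (forall n, measurable_fun setT (etas n)) ->
  (forall n z, `|etas n z| <= M) ->
  (forall z, etas n z @[n --> \oo] --> eta z) ->
  F (fun z => h z + eps n * etas n z) @[n --> \oo] --> F h.
Proof.
move=> dF e0 ecv mE ME Ecv.
have dFc := dF eps etas M e0 ecv mE ME Ecv; rewrite -[F h]addr0 -(mul0r a).
apply: (cvg_eq_seq (cvgD (cvg_cst (F h)) (cvgM ecv dFc))) => n /=.
by rewrite mulVKf// addrC subrK.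
Qed.

Lemma chain_deriveM F G h eta a b : is_chain_derive F h eta a ->
  is_chain_derive G h eta b ->
  is_chain_derive (fun g => F g * G g) h eta (F h * b + a * G h).
Proof.
move=> dF dG eps etas M e0 ecv mE ME Ecv.
have Fcv := chain_derive_cvg dF e0 ecv mE ME Ecv.
have dFc := dF eps etas M e0 ecv mE ME Ecv.
have dGc := dG eps etas M e0 ecv mE ME Ecv.
by apply: (cvg_eq_seq (cvgD (cvgM Fcv dGc) (cvgM dFc (cvg_cst (G h))))) => n /=; ring.
Qed.

(** Caratheodory's form phi y - phi x = psi y * (y - x), with psi continuous at x,
avoids dividing by increments of F, which may vanish. *)
Lemma chain_derive_comp (phi : R -> R) F h eta a d : is_chain_derive F h eta a ->
  is_derive (F h) 1 phi d -> is_chain_derive (phi \o F) h eta (d * a).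
Proof.
move=> dF /is_derive1_caratheodory[psi [psiE psicont psiFh]].
move=> eps etas M e0 ecv mE ME Ecv.
have Fcv := chain_derive_cvg dF e0 ecv mE ME Ecv.
have dFc := dF eps etas M e0 ecv mE ME Ecv.
rewrite -psiFh.
apply: (cvg_eq_seq (cvgM (continuous_cvg _ psicont Fcv) dFc)) => n /=.
by rewrite psiE; ring.
Qed.

Lemma integrable_bounded_mul g w : lam.-integrable setT (EFin \o w) ->
  bounded_measurable g ->
  lam.-integrable setT (EFin \o (fun z => g z * w z)).
Proof.
move=> iw [mg [M gM]]; rewrite (_ : EFin \o _ = ((EFin \o g) \* (EFin \o w))%E)//.
apply: integrableMr => //; exists M; split; first exact: num_real.
by move=> N MN z _; exact: le_trans (gM z) (ltW MN).
Qed.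

(** The difference quotient of an affine functional is the integral of the
direction etas n against w, exactly; the uniform bound on the directions makes
dominated convergence applicable. *)
Lemma chain_derive_affine F c w h (B : set Z) :
  lam.-integrable setT (EFin \o w) ->
  (forall g, bounded_measurable g -> F g = c + \int[lam]_z (g z * w z)) ->
  bounded_measurable h -> measurable B ->
  is_chain_derive F h \1_B (\int[lam]_(z in B) w z).
Proof.
move=> iw FE bh mB eps etas M e0 ecv mE ME Ecv.
have mw : measurable_fun setT w by apply/measurable_EFinP; case/integrableP: iw.
have bE n : bounded_measurable (etas n) by split=> //; exists M.
have FhE n : (eps n)^-1 * (F (fun z => h z + eps n * etas n z) - F h) =
    \int[lam]_z (etas n z * w z).
  have [mh [N hN]] := bh.
  have bhE : bounded_measurable (fun z => h z + eps n * etas n z).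
    split; first by apply: measurable_funD => //; exact: measurable_funM.
    exists (N + `|eps n| * M) => z.
    by rewrite (le_trans (ler_normD _ _))// lerD// normrM ler_wpM2l.
  rewrite !FE//; under eq_Rintegral do rewrite mulrDl -mulrA.
  rewrite RintegralD//=; last 2 first.
  - exact: integrable_bounded_mul.
  - apply: (@integrable_bounded_mul (cst (eps n)) (fun z => etas n z * w z)).
      exact: integrable_bounded_mul.
    by split=> //; exists `|eps n|.
  rewrite RintegralZl//; last exact: integrable_bounded_mul.
  by rewrite opprD addrACA subrr add0r addrAC subrr add0r mulKf.
under eq_fun do rewrite FhE.
have idom : lam.-integrable setT (EFin \o (fun z => M * `|w z|)).
  rewrite (_ : EFin \o _ = (fun z => M%:E * `|(EFin \o w) z|)%E).
    by apply: integrableZl => //; exact: integrable_abse.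
  by apply/funext => z; rewrite /= EFinM.
have -> : \int[lam]_(z in B) w z = \int[lam]_z (\1_B z * w z).
  rewrite Rintegral_mkcond; apply: eq_Rintegral => z _.
  by rewrite patchE indicE; case: (z \in B); rewrite ?mul1r ?mul0r.
apply: fine_cvg.
rewrite fineK.
  have [] := @dominated_convergence _ _ _ lam setT measurableT
    (fun n z => (etas n z * w z)%:E) (fun z => (\1_B z * w z)%:E)
    (fun z => (M * `|w z|)%:E) => //.
  - by move=> n; apply/measurable_EFinP; exact: measurable_funM.
  - by apply/measurable_EFinP; exact: measurable_funM.
  - apply: aeW => z _; apply: cvg_EFin; first exact: nearW.
    by apply: cvgM => //; exact: cvg_cst.
  - by apply: aeW => z n _; rewrite /= lee_fin normrM ler_wpM2r.
apply: integrable_fin_num => //; apply: integrable_bounded_mul => //.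
split=> //; exists 1 => z.
by rewrite indicE; case: (_ \in _); rewrite ?normr1 ?normr0.
Qed.
End chain_derivative.

(** * Exchanging target and measurement integrals *)

Section exchange.
Context {R : realType} {dX dZ : measure_display}.
Context {X : measurableType dX} {Z : measurableType dZ}.
Variable lam : {sigma_finite_measure set Z -> \bar R}.
Variable P : probability X R.
Variable K : Z -> X -> R.
Hypothesis mK : measurable_fun setT (fun zx : Z * X => K zx.1 zx.2).
Hypothesis K0 : forall z x, 0 <= K z x.
Hypothesis K1 : forall x, (\int[lam]_z (K z x)%:E <= 1)%E.

(* [a z] is 0 by convention when the integral is infinite, which happens on a
   lam-null set only. *)
Let a z := \int[P]_x K z x.

Let mEK : measurable_fun setT (fun zx : Z * X => (K zx.1 zx.2)%:E).
Proof. exact/measurable_EFinP. Qed.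

Let mEKl z : measurable_fun setT (fun x => (K z x)%:E).
Proof. exact: (measurable_fun_pair2 z mEK). Qed.

Let mA : measurable_fun setT (fun z => \int[P]_x (K z x)%:E)%E.
Proof. by apply: (measurable_fun_fubini_tonelli_F _ mEK) => zx; rewrite lee_fin. Qed.

Let iA : lam.-integrable setT (fun z => \int[P]_x (K z x)%:E)%E.
Proof.
apply/integrableP; split=> //.
under eq_integral.
  move=> z _; rewrite gee0_abs; last by apply: integral_ge0 => x _; rewrite lee_fin.
  over.
rewrite /=.
have ft := @fubini_tonelli _ _ _ _ _ lam P _ mEK (fun zx => K0 zx.1 zx.2).
rewrite [ltLHS]ft.
apply: (@le_lt_trans _ _ (\int[P]_x 1)%E); last first.
  by rewrite integral_cst// mul1e ltey_eq fin_num_measure.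
apply: ge0_le_integral => //.
- by move=> x _; apply: integral_ge0 => z _; rewrite lee_fin.
- by apply: (measurable_fun_fubini_tonelli_G _ mEK) => zx; rewrite lee_fin.
- by move=> x _; exact: K1.
Qed.

(** Tonelli: the total mass of the marginal is at most the mass 1 of P. *)
Lemma integrable_marginal : lam.-integrable setT (EFin \o a).
Proof.
apply: le_integrable iA => //.
- apply/measurable_EFinP; exact: measurableT_comp.
- move=> z _ /=; rewrite /a /Rintegral.
  by case: (\int[P]_x _)%E => [r| |] //=; rewrite normr0 leey.
Qed.

Lemma integrable_kernel_slice g x : bounded_measurable g ->
  lam.-integrable setT (EFin \o (fun z => g z * K z x)).
Proof.
apply: integrable_bounded_mul; apply/integrableP; split.
  apply/measurable_EFinP.
  exact: (measurable_fun_pair1 x mK).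
under eq_integral do rewrite gee0_abs ?lee_fin//.
by rewrite (le_lt_trans (K1 x))// ltry.
Qed.

Section weight.
Variable g : Z -> R.
Hypothesis bg : bounded_measurable g.

Let f (zx : Z * X) := (g zx.1 * K zx.1 zx.2)%:E.

Let f_integrable : (lam \x P)%E.-integrable setT f.
Proof.
have [mg [M gM]] := bg.
have mf : measurable_fun setT f.
  apply/measurable_EFinP; apply: measurable_funM => //.
  exact: measurableT_comp.
apply: (@integrable12ltyP _ _ _ _ _ lam P f mf).2.
have := integrableZl measurableT `|M| iA => /integrableP[_].
apply: le_lt_trans; apply: ge0_le_integral => //.
- by move=> z _; exact: integral_ge0.
- apply: (measurable_fun_fubini_tonelli_F (abse \o f)).
    exact: measurableT_comp.
  by move=> zx; exact: abse_ge0.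
- by apply: measurableT_comp => //; exact: measurable_funeM.
- move=> z _; rewrite abseM gee0_abs ?lee_fin// gee0_abs; last first.
    by apply: integral_ge0 => x _; rewrite lee_fin.
  rewrite -ge0_integralZl//; last by move=> x _; rewrite lee_fin.
  apply: ge0_le_integral => //.
  + apply: measurableT_comp => //.
    exact: (measurable_fun_pair2 z mf).
  + exact: measurable_funeM.
  + move=> x _; rewrite /f/= lee_fin normrM (ger0_norm (K0 _ _)).
    by rewrite ler_wpM2r// (le_trans (gM z))// ler_norm.
Qed.

(** Both inner integrals are real-valued. The one over Z is always finite; the one
over X is finite for almost every z, where it agrees with [g z * a z]. *)
Lemma Fubini_weight :
  \int[P]_x \int[lam]_z (g z * K z x) = \int[lam]_z (g z * a z).
Proof.
have fub := Fubini f_integrable.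
rewrite /Rintegral; congr fine; transitivity (\int[P]_x \int[lam]_z f (z, x))%E.
  apply: eq_integral => x _; rewrite fineK//; apply: integrable_fin_num => //.
  exact: integrable_kernel_slice.
rewrite -fub; apply: ae_eq_integral => //.
- exact: measurable_fubini_F f_integrable.
- exact: (measurable_int lam (integrable_bounded_mul integrable_marginal bg)).
(* outside the null set of infinite marginals the two integrands coincide *)
- have := integrable_ae measurableT iA; apply: filterS => z /(_ I) Afin _.
  rewrite /f/= EFinM -[(a z)%:E]/(fine (\int[P]_x (K z x)%:E)%E)%:E fineK//.
  under eq_integral do rewrite EFinM.
  rewrite integralZl//; apply/integrableP; split=> //.
  under eq_integral do rewrite gee0_abs ?lee_fin//.
  by rewrite ltey_eq Afin.
Qed.

Lemma measurable_weight : measurable_fun setT (fun x => \int[lam]_z (g z * K z x)).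
Proof. exact: measurableT_comp (measurable_fubini_G f_integrable). Qed.
End weight.
End exchange.

Section nonneg_weight.
Context {R : realType} {dZ : measure_display} {Z : measurableType dZ}.
Variable lam : {sigma_finite_measure set Z -> \bar R}.
Variable w : Z -> R.
Hypothesis iw : lam.-integrable setT (EFin \o w).
Hypothesis w0 : forall z, 0 <= w z.

Lemma weighted_integral_le (h : Z -> R) (r : R) : measurable_fun setT h ->
  (forall z, `|h z| <= r) ->
  `|\int[lam]_z (h z * w z)| <= r * \int[lam]_z w z.
Proof.
move=> mh hr; have bh : bounded_measurable h by split=> //; exists r.
have ihw := integrable_bounded_mul iw bh.
apply: le_trans (le_normr_Rintegral _ ihw) _ => //.
rewrite -RintegralZl//; apply: le_Rintegral => //.
- exact: (@integrable_abse _ _ _ lam setT (EFin \o (fun z => h z * w z))).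
- by apply: (@integrable_bounded_mul _ _ _ _ (cst r)) => //; split=> //; exists `|r|.
- by move=> z _; rewrite normrM (ger0_norm (w0 z)) ler_wpM2r.
Qed.
End nonneg_weight.

Section detection.
Context {R : realType} {dX dZ : measure_display}.
Context {X : measurableType dX} {Z : measurableType dZ}.
Variable lam : {sigma_finite_measure set Z -> \bar R}.
Variable P : probability X R.
Variables (p : X -> R) (l : Z -> X -> R).
Hypothesis mp : measurable_fun setT p.
Hypothesis p01 : forall x, 0 <= p x <= 1.
Hypothesis ml : measurable_fun setT (fun zx : Z * X => l zx.1 zx.2).
Hypothesis l0 : forall z x, 0 <= l z x.
Hypothesis l1 : forall x, (\int[lam]_z (l z x)%:E = 1)%E.

(** Density of the law of the measurement generated by a target of law P; its mass
falls short of 1 by the probability that the target is missed. *)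
Definition detection_density z := \int[P]_x (p x * l z x).
Definition missed_prob := \int[P]_x (1 - p x).
Local Notation a := detection_density.
Local Notation q := missed_prob.

Let K z x := p x * l z x.

Let mK : measurable_fun setT (fun zx : Z * X => K zx.1 zx.2).
Proof. by apply: measurable_funM => //; exact: measurableT_comp. Qed.

Let K0 z x : 0 <= K z x.
Proof. by rewrite mulr_ge0//; have /andP[] := p01 x. Qed.

Let mlx x : measurable_fun setT (fun z => (l z x)%:E).
Proof. apply/measurable_EFinP; exact: measurable_fun_pair1 x ml. Qed.

Let K1 x : (\int[lam]_z (K z x)%:E <= 1)%E.
Proof.
have /andP[p0 p1] := p01 x.
under eq_integral do rewrite /K EFinM.
rewrite ge0_integralZl//; last by move=> z _; rewrite lee_fin.
by rewrite l1 mule1 lee_fin.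
Qed.

Let il x : lam.-integrable setT (EFin \o l ^~ x).
Proof.
apply/integrableP; split; first exact: mlx.
under eq_integral do rewrite gee0_abs ?lee_fin//.
by rewrite l1 ltry.
Qed.

Let bounded_integrable (f : X -> R) : measurable_fun setT f ->
    (exists M : R, forall x, `|f x| <= M) ->
  P.-integrable setT (EFin \o f).
Proof.
move=> mf [M fM]; apply: measurable_bounded_integrable => //.
  by rewrite ltey_eq fin_num_measure.
exists M; split; first exact: num_real.
by move=> N MN z _; exact: le_trans (fM z) (ltW MN).
Qed.

Let ip : P.-integrable setT (EFin \o p).
Proof.
by apply: bounded_integrable => //; exists 1 => x;
  have /andP[? ?] := p01 x; rewrite ger0_norm.
Qed.

Let i1 : P.-integrable setT (EFin \o cst (1 : R)).
Proof. by apply: bounded_integrable => //; exists 1 => x; rewrite normr1. Qed.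

Let R1 : \int[P]_x 1 = 1 :> R.
Proof. by rewrite Rintegral_cst// mul1r /= probability_setT. Qed.

Lemma missed_probE : q = 1 - \int[P]_x p x.
Proof. by rewrite /missed_prob RintegralB// R1. Qed.

Lemma missed_prob_ge0 : 0 <= q.
Proof. by apply: Rintegral_ge0 => x _; rewrite subr_ge0; have /andP[] := p01 x. Qed.

Lemma missed_prob_le1 : q <= 1.
Proof.
rewrite missed_probE gerBl; apply: Rintegral_ge0 => x _; by have /andP[] := p01 x.
Qed.

Lemma detection_density_ge0 z : 0 <= a z.
Proof. by apply: Rintegral_ge0 => x _; exact: K0. Qed.

Lemma integrable_detection_density : lam.-integrable setT (EFin \o a).
Proof. exact: (integrable_marginal P mK K0 K1). Qed.

Lemma target_pgfl_arg g : bounded_measurable g ->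
  \int[P]_x (1 - p x + p x * \int[lam]_z (g z * l z x)) =
  q + \int[lam]_z (g z * a z).
Proof.
move=> bg; have [mg [M gM]] := bg.
have E x : p x * \int[lam]_z (g z * l z x) = \int[lam]_z (g z * K z x).
  rewrite -RintegralZl//; last exact: integrable_bounded_mul.
  by apply: eq_Rintegral => z _; rewrite /K mulrCA.
under eq_Rintegral do rewrite E.
rewrite -(Fubini_weight P mK K0 K1)// RintegralD//.
  by apply: bounded_integrable;
    [exact: measurable_funB|exists 1 => x; have /andP[? ?] := p01 x;
     rewrite ger0_norm ?subr_ge0// gerBl].
apply: bounded_integrable; first exact: (measurable_weight P mK K0 K1 bg).
exists M => x; rewrite -E normrM.
have := weighted_integral_le (il x) (l0^~ x) mg gM.
rewrite [X in M * X]/Rintegral l1 mulr1.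
have /andP[p0 p1] := p01 x; rewrite (ger0_norm p0) => H; apply: le_trans H.
by rewrite ler_piMl.
Qed.

(** Take g = 1 in the preceding identity, whose left-hand side is then
\int 1 dP = 1. *)
Lemma detection_density_mass : \int[lam]_z a z = 1 - q.
Proof.
have b1 : @bounded_measurable R _ Z (cst 1).
  by split=> //; exists 1 => z; rewrite normr1.
have := target_pgfl_arg b1.
under eq_Rintegral do under eq_Rintegral do rewrite mul1r.
under [in X in _ = _ + X -> _]eq_Rintegral do rewrite mul1r.
rewrite (_ : \int[P]_x _ = 1); first by move=> ->; rewrite addrAC subrr add0r.
rewrite -[RHS]R1; apply: eq_Rintegral => x _.
by rewrite /Rintegral l1 mulr1 subrK.
Qed.

(** A vanishing mean detection probability means p = 0 almost everywhere, so that
the density vanishes at every z and not just at almost every z. *)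
Lemma detection_density_eq0 z : q = 1 -> a z = 0.
Proof.
rewrite missed_probE => q1; have ip0 : \int[P]_x p x = 0 by lra.
have : ae_eq P setT (EFin \o p) (cst 0%E).
  apply/ae_eq_integral_abs => //; first exact/measurable_EFinP.
  under eq_integral => x _.
    rewrite gee0_abs ?lee_fin; last by have /andP[] := p01 x.
    over.
  by rewrite -[LHS]fineK ?(integrable_fin_num _ ip)// -/(Rintegral _ _ _) ip0.
move=> p0; rewrite /detection_density /Rintegral.
rewrite (@ae_eq_integral _ _ _ P setT (cst 0%E))//.
- by rewrite integral0.
- apply/measurable_EFinP; exact: measurable_fun_pair2 z mK.
- by apply: filterS p0 => x /= /(_ I) [->] _; rewrite mul0r.
Qed.

(** If |h| <= r < 1, the argument is at most q + r (1 - q), which is below 1 as soon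
as q < 1. The value q = 1 is the degenerate case of undetectable targets. *)
Lemma target_arg_lt1 h : test_fun h ->
  `|q + \int[lam]_z (h z * a z)| < 1 \/ forall z, a z = 0.
Proof.
move=> [mh [r r1 hr]]; have [q1|q1] := eqVneq q 1.
  by right=> z; exact: detection_density_eq0.
left; have q1' : q < 1 by rewrite lt_neqAle q1 missed_prob_le1.
have := weighted_integral_le integrable_detection_density detection_density_ge0 mh hr.
rewrite detection_density_mass => H.
apply: le_lt_trans (ler_normD _ _) _; rewrite ger0_norm ?missed_prob_ge0//.
by nra.
Qed.
End detection.

(** * Iterated derivatives of the observation functional *)

Section power_set_sum.
Context {T : choiceType} {V : nmodType}.

(** A subset of z |` A either avoids z or is z |` B for a unique subset B of A. *)
Lemma sum_fpowersetU1 (z : T) (A : {fset T}) (F : {fset T} -> V) : z \notin A ->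
  \sum_(B <- fpowerset (z |` A)%fset) F B =
  \sum_(B <- fpowerset A) F B + \sum_(B <- fpowerset A) F (z |` B)%fset.
Proof.
move=> zA; have zB B : B \in fpowerset A -> z \notin B.
  by rewrite fpowersetE => /fsubsetP BA; apply: contra zA; exact: BA.
rewrite (big_fsetID _ (fun B : {fset T} => z \notin B)) /=; congr (_ + _)%R.
  apply: eq_fbigl => B; rewrite !inE !fpowersetE.
  apply/andP/idP => [[/fsubsetP BzA zB']|BA].
    apply/fsubsetP => t tB; have := BzA t tB.
    by rewrite !inE => /orP[/eqP tz|//]; rewrite -tz tB in zB'.
  split; last by apply: zB; rewrite fpowersetE.
  by apply: fsubset_trans BA _; exact: fsubsetU1.
transitivity (\sum_(B <- [fset (z |` B)%fset | B in fpowerset A]%fset) F B);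
  last first.
  apply: big_imfset => B C BA CA BC.
  by rewrite -(fsetU1K (zB _ BA)) -(fsetU1K (zB _ CA)) BC.
apply: eq_fbigl => B; rewrite !inE /= negbK.
apply/andP/imfsetP => [[BzA zB']|[C /= CA ->]].
  exists (B `\ z)%fset; last by rewrite fsetD1K.
  by move: BzA; rewrite !fpowersetE fsubDset.
split; last by rewrite !inE eqxx.
by move: CA; rewrite !fpowersetE; exact: fsetUS.
Qed.
End power_set_sum.

Section split_sum.
Context {R : realType} {T : choiceType}.
Variables a b : T -> R.
Implicit Types (f : nat -> nat -> R) (s : seq T).

(** Every point of [s] is either of kind b, which raises the first order i, or of
kind a, which raises the second order j. Accumulating the orders on the way down
turns both adding a point at the end and differentiating [f] into the same
recurrence. *)
Fixpoint split_sum f s i j : R :=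
  match s with
  | [::] => f i j
  | z :: s' => b z * split_sum f s' i.+1 j + a z * split_sum f s' i j.+1
  end.

Lemma split_sum_rcons f s z i j : split_sum f (rcons s z) i j =
  b z * split_sum f s i.+1 j + a z * split_sum f s i j.+1.
Proof. by elim: s i j => //= y s IH i j; rewrite !IH; ring. Qed.

(** B is the set of the points of kind a. *)
Lemma split_sumE f s i j : uniq s ->
  split_sum f s i j =
  \sum_(B <- fpowerset [fset z in s]%fset)
    (\prod_(z <- B) a z) * (\prod_(z <- ([fset z in s] `\` B)%fset) b z) *
    f (i + (size s - #|` B|))%N (j + #|` B|)%N.
Proof.
elim: s i j => [|z s IH] i j /=.
  rewrite (_ : [fset z in [::]]%fset = fset0); last first.
    by apply/fsetP => t; rewrite !inE.
  rewrite fpowerset0 big_seq_fset1 fset0D !big_seq_fset0 cardfs0.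
  by rewrite subn0 !addn0 !mul1r.
move=> /andP[zs us]; rewrite !IH// fset_cons.
have zA : z \notin [fset z in s]%fset by rewrite !inE.
rewrite sum_fpowersetU1// !mulr_sumr; congr (_ + _).
- apply: eq_big_seq => B; rewrite fpowersetE => BA.
  have zB : z \notin B by apply: contra zA => /(fsubsetP BA).
  have /fsetDidPl zBE : [disjoint [fset z] & B]%fset by rewrite fdisjoint1X.
  rewrite fsetDUl zBE.
  rewrite (@big_fsetU1 _ _ _ _ z)/=; last by rewrite !inE (negPf zs) andbF.
  have Bs : (#|` B| <= size s)%N.
    by rewrite (leq_trans (fsubset_leq_card BA))// card_fseq undup_id.
  by rewrite subSn// addnS addSn; ring.
- apply: eq_big_seq => B; rewrite fpowersetE => BA.
  have zB : z \notin B by apply: contra zA => /(fsubsetP BA).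
  rewrite big_fsetU1//= cardfsU1 zB add1n subSS addnS addSn.
  rewrite (_ : ((z |` [fset z in s]) `\` (z |` B) = [fset z in s] `\` B)%fset).
    by ring.
  apply/fsetP => t; rewrite !inE negb_or.
  by have [->|] := eqVneq t z; rewrite ?(negPf zs) ?andbF.
Qed.
End split_sum.

Section split_sum_chain_derive.
Context {R : realType} {dZ : measure_display} {Z : measurableType dZ}.

(** Differentiation acts on [f] as one more point of weights eb and ea, and it
commutes with the linear recurrence. *)
Lemma chain_derive_split_sum (a b : Z -> R) (f : nat -> nat -> (Z -> R) -> R)
    (h eta : Z -> R) (ea eb : R) :
  (forall i j, is_chain_derive (f i j) h eta
    (eb * f i.+1 j h + ea * f i j.+1 h)) ->
  forall s i j, is_chain_derive
    (fun g => split_sum a b (fun i j => f i j g) s i j) h eta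
    (eb * split_sum a b (fun i j => f i j h) s i.+1 j +
     ea * split_sum a b (fun i j => f i j h) s i j.+1).
Proof.
move=> df; elim=> [|z s IH] i j /=; first exact: df.
have := chain_deriveD (chain_deriveZ (c := b z) (IH i.+1 j))
  (chain_deriveZ (c := a z) (IH i j.+1)).
by congr is_chain_derive; ring.
Qed.
End split_sum_chain_derive.

Section cphd_derivative.
Context {R : realType} {dZ : measure_display} {Z : measurableType dZ}.
Variable lam : {sigma_finite_measure set Z -> \bar R}.
Variables (rho rho_c : nat -> R).
Hypothesis rhoP : is_card_distr rho.
Hypothesis rhocP : is_card_distr rho_c.
Variables (a b : Z -> R) (q : R).
Hypothesis ia : lam.-integrable setT (EFin \o a).
Hypothesis ib : lam.-integrable setT (EFin \o b).

Let u g := q + \int[lam]_z (g z * a z).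
Let c g := \int[lam]_z (g z * b z).

Hypothesis u_lt1 : forall h, test_fun h -> `|u h| < 1 \/ forall z, a z = 0.
Hypothesis c_lt1 : forall h, test_fun h -> `|c h| < 1.

Let pgf_prod i j g :=
  card_pgf (deriv_coef rho_c i) (c g) * card_pgf (deriv_coef rho j) (u g).

Definition cphd_deriv s g := split_sum a b (fun i j => pgf_prod i j g) s 0 0.

(** When a vanishes, u may lie on the unit circle, where the power series need not
be differentiable; but then u is constant and \int_B a = 0. *)
Lemma chain_derive_pgf_prod i j h (B : set Z) : test_fun h -> measurable B ->
  is_chain_derive (pgf_prod i j) h \1_B
    ((\int[lam]_(z in B) b z) * pgf_prod i.+1 j h +
     (\int[lam]_(z in B) a z) * pgf_prod i j.+1 h).
Proof.
move=> th mB; have bh := test_fun_bounded th.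
have dc : is_chain_derive (card_pgf (deriv_coef rho_c i) \o c) h \1_B
    (card_pgf (deriv_coef rho_c i.+1) (c h) * \int[lam]_(z in B) b z).
  apply: chain_derive_comp.
    by apply: (@chain_derive_affine _ _ _ lam c 0) => // g _; rewrite add0r.
  apply: is_derive_card_pgf; last exact: c_lt1.
  by move=> y; exact: card_distr_cvg_pseries.
have du : is_chain_derive (card_pgf (deriv_coef rho j) \o u) h \1_B
    (card_pgf (deriv_coef rho j.+1) (u h) * \int[lam]_(z in B) a z).
  have [uh|a0] := u_lt1 th.
    apply: chain_derive_comp; first exact: (@chain_derive_affine _ _ _ lam u q).
    apply: is_derive_card_pgf => //.
    by move=> y; exact: card_distr_cvg_pseries.
  have -> : card_pgf (deriv_coef rho j) \o u = fun=> card_pgf (deriv_coef rho j) q.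
    apply/funext => g /=; congr card_pgf; rewrite /u.
    under eq_Rintegral do rewrite a0 mulr0.
    by rewrite /Rintegral integral0 addr0.
  rewrite (_ : \int[lam]_(z in B) a z = 0).
    by rewrite mulr0; exact: chain_derive_cst.
  under eq_Rintegral do rewrite a0.
  by rewrite /Rintegral integral0.
have := chain_deriveM dc du.
by congr is_chain_derive; rewrite /pgf_prod /=; ring.
Qed.

Lemma cphd_deriv_dirac s h : test_fun h ->
  is_dirac_derive lam (cphd_deriv s) h (fun z => cphd_deriv (rcons s z) h).
Proof.
move=> th.
set S1 := split_sum a b (fun i j => pgf_prod i j h) s 1 0.
set S2 := split_sum a b (fun i j => pgf_prod i j h) s 0 1.
have E z : cphd_deriv (rcons s z) h = S1 * b z + S2 * a z.
  by rewrite /cphd_deriv split_sum_rcons mulrC [a z * _]mulrC.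
have i1 : lam.-integrable setT (EFin \o (fun z => S1 * b z)).
  rewrite (_ : EFin \o _ = (fun z => S1%:E * (EFin \o b) z)%E)//.
  exact: integrableZl.
have i2 : lam.-integrable setT (EFin \o (fun z => S2 * a z)).
  rewrite (_ : EFin \o _ = (fun z => S2%:E * (EFin \o a) z)%E)//.
  exact: integrableZl.
split.
  rewrite (_ : EFin \o _ = ((EFin \o (fun z => (S1 * b z)%R)) \+
      (EFin \o (fun z => (S2 * a z)%R)))%E).
    exact: integrableD.
  by apply/funext => z; rewrite /= E.
move=> B mB.
under eq_Rintegral do rewrite E.
have sub f : lam.-integrable setT f -> lam.-integrable B f.
  by move=> ifs; exact: integrableS ifs.
rewrite RintegralD ?sub// !RintegralZl ?sub// mulrC [S2 * _]mulrC.
apply: (@chain_derive_split_sum _ _ _ a b pgf_prod h \1_B) => i j.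
exact: chain_derive_pgf_prod.
Qed.
End cphd_derivative.

(** * The closed formula *)

Section falling_series.
Context {R : realType}.

(** The terms of index n < j vanish, and the others are those of the derived
series, shifted by j. *)
Lemma cvg_ffact_series (rho : nat -> R) j x : is_card_distr rho -> `|x| < 1 ->
  series (fun n => (n ^_ j)%:R * rho n * x ^+ (n - j)) n @[n --> \oo] -->
  card_pgf (deriv_coef rho j) x.
Proof.
move=> rhoP x1; rewrite -(cvg_shiftn j).
have cv : pseries (deriv_coef rho j) x n @[n --> \oo] --> card_pgf (deriv_coef rho j) x.
  by apply: cvg_pseries_deriv_coef => // y; exact: card_distr_cvg_pseries.
apply: (cvg_eq_seq cv) => n.
rewrite /pseries /series /= [RHS](@big_cat_nat _ _ _ j)/= ?leq_addl//.
rewrite [X in _ = X + _]big_nat_cond [X in _ = X + _]big1 ?add0r; last first.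
  by move=> k /andP[/andP[_ kj] _]; rewrite ffact_small// !mul0r.
have shift (F : nat -> R) : \sum_(j <= k < n + j) F k = \sum_(0 <= k < n) F (k + j)%N.
  by rewrite -{1}[j]add0n big_addn addnK.
by rewrite shift; apply: eq_bigr => k _; rewrite deriv_coefE addnK.
Qed.
End falling_series.

Section mass_normalization.
Context {R : realType}.

Lemma prodr_scale_fset (T : choiceType) (A : {fset T}) (M : R) (F : T -> R) :
  \prod_(z <- A) (M * F z) = M ^+ #|` A| * \prod_(z <- A) F z.
Proof. by rewrite big_split /= big_const_seq count_predT iter_mulr_1. Qed.

Lemma big_card_fpowerset (T : choiceType) (A : {fset T}) k (F : nat -> {fset T} -> R) :
  \sum_(0 <= j < k) \sum_(B <- fpowerset A | #|` B| == j) F j B =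
  \sum_(B <- fpowerset A) (if (#|` B| < k)%N then F #|` B| B else 0).
Proof.
under eq_bigr do rewrite big_mkcond.
rewrite exchange_big /=; apply: eq_bigr => B _.
rewrite -big_mkcond/= (eq_bigl (eq_op^~ #|` B|)); last by move=> j; rewrite eq_sym.
by rewrite big_nat1_eq.
Qed.

(** A product of n factors scaled by M carries M ^ n, which the normalization
divides out. For M = 0 the division by 0 is harmless: the cardinality is then
concentrated at 0, where the exponent is 0 as well. *)
Lemma mass_cancel (rho : nat -> R) (M : R) n k : (k <= n)%N ->
  (M = 0 -> forall n, (0 < n)%N -> rho n = 0) ->
  mass_normalized rho M n * (M ^+ (n - k) * M ^+ k) = rho n.
Proof.
move=> kn M0; rewrite /mass_normalized -exprD subnK//.
have [n0|n0] := posnP n; first by rewrite n0 expr0 divr1 mulr1.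
have [M00|M00] := eqVneq M 0; first by rewrite M0// !mul0r.
by rewrite divfK// expf_neq0.
Qed.
End mass_normalization.

Section upsilon.
Context {R : realType} {dX dZ : measure_display}.
Context {X : measurableType dX} {Z : measurableType dZ} {S : Type}.
Variables (pd : X -> S -> R) (ell : Z -> X -> S -> R).
Variables (mu : S -> {finite_measure set X -> \bar R}) (s : S) (muc : Z -> R).
Variables (rho rho_c : nat -> R) (Mt Mc q : R) (a b : Z -> R).
Hypothesis missedE : missed_detection pd mu s = Mt * q.
Hypothesis associationE : forall z, association pd ell mu s z = Mt * a z.
Hypothesis mucE : forall z, muc z = Mc * b z.
Hypothesis Mt0 : Mt = 0 -> forall n, (0 < n)%N -> rho n = 0.
Hypothesis Mc0 : Mc = 0 -> forall n, (0 < n)%N -> rho_c n = 0.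

(** The subsets of more than n points contribute nothing on either side: they are
excluded from the sum on the left, and on the right the falling factorial is 0. *)
Lemma Upsilon0_mass_normalized (A : {fset Z}) n :
  Upsilon0 pd ell (mass_normalized rho_c Mc) muc mu s A n * mass_normalized rho Mt n =
  \sum_(B <- fpowerset A)
    (\prod_(z <- B) a z) * (\prod_(z <- (A `\` B)%fset) b z) *
    ((#|` A| - #|` B|)`!%:R * rho_c (#|` A| - #|` B|)%N) *
    ((n ^_ #|` B|)%:R * rho n * q ^+ (n - #|` B|)).
Proof.
rewrite /Upsilon0; under eq_bigr do rewrite mulr_sumr.
rewrite big_card_fpowerset mulr_suml; apply: eq_big_seq => B.
rewrite fpowersetE => BA; have BAc := fsubset_leq_card BA.
rewrite ltnS leq_min BAc /=; case: leqP => Bn; last first.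
  by rewrite ffact_small// !mul0r mulr0.
have -> : \prod_(z <- B) association pd ell mu s z = Mt ^+ #|` B| * \prod_(z <- B) a z.
  by rewrite -prodr_scale_fset; apply: eq_bigr => z _.
have -> : \prod_(z <- (A `\` B)%fset) muc z =
    Mc ^+ #|` (A `\` B)%fset| * \prod_(z <- (A `\` B)%fset) b z.
  by rewrite -prodr_scale_fset; apply: eq_bigr => z _.
rewrite missedE exprMn.
rewrite cardfsD (fsetIidPr BA).
rewrite -[X in _ = _ * (_ * X) * _](@mass_cancel _ _ Mc _ 0)// subn0 expr0 mulr1.
rewrite -[X in _ = _ * (_ * X * _)](@mass_cancel _ _ Mt _ #|` B|)//.
rewrite -(ffact_fact Bn) natrM mulrAC.
have f0 : (n - #|` B|)`!%:R != 0 :> R by rewrite pnatr_eq0 -lt0n fact_gt0.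
by move: (mass_normalized _ _ _) (mass_normalized _ _ _) => x y; field.
Qed.

Variable lam : {sigma_finite_measure set Z -> \bar R}.
Hypothesis rhoP : is_card_distr rho.
Hypothesis q0 : 0 <= q.
Hypothesis q1 : q < 1 \/ (q = 1 /\ forall z, a z = 0).

(** For q = 1 the series itself may diverge, but then a = 0, so the product over
B kills it unless B is empty, and in that case it is the total mass of rho. *)
Lemma cvg_ffact_series_density (B : {fset Z}) :
  \prod_(z <- B) a z *
    series (fun n => (n ^_ #|` B|)%:R * rho n * q ^+ (n - #|` B|)) n
  @[n --> \oo] -->
  \prod_(z <- B) a z * card_pgf (deriv_coef rho #|` B|) q.
Proof.
have [q1'|[q1' a0]] := q1.
  apply: cvgM; first exact: cvg_cst.
  by apply: cvg_ffact_series; rewrite ?ger0_norm.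
have [->|/fset0Pn[z zB]] := eqVneq B fset0.
  apply: cvgM; first exact: cvg_cst.
  rewrite cardfs0 q1' card_pgf1//.
  apply: cvg_eq_seq (card_distr_cvg rhoP) _ => n.
  by apply: eq_bigr => k _; rewrite ffactn0 mul1r expr1n mulr1.
rewrite (big_fsetD1 z zB)/= a0 !mul0r.
by under eq_fun do rewrite mul0r; exact: cvg_cst.
Qed.

Lemma cphd_deriv0E (zs : seq Z) : uniq zs ->
  (cphd_deriv lam rho rho_c a b q zs (fun=> 0))%:E =
  inner (Upsilon0 pd ell (mass_normalized rho_c Mc) muc mu s [fset z in zs]%fset)
    (mass_normalized rho Mt).
Proof.
move=> uzs; apply/esym/cvg_lim => //.
have I0 (w : Z -> R) : \int[lam]_z (0 * w z) = 0.
  by under eq_Rintegral do rewrite mul0r; rewrite /Rintegral integral0.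
have szA : #|` [fset z in zs]%fset| = size zs by rewrite card_fseq undup_id.
rewrite /cphd_deriv split_sumE// !I0 addr0 /=.
under eq_fun do rewrite sumEFin; apply: cvg_EFin; first exact: nearW.
set w := fun B : {fset Z} => \prod_(z <- ([fset z in zs] `\` B)%fset) b z *
  ((size zs - #|` B|)`!%:R * rho_c (size zs - #|` B|)%N).
have E N : \sum_(0 <= n < N)
    (Upsilon0 pd ell (mass_normalized rho_c Mc) muc mu s [fset z in zs]%fset n *
     mass_normalized rho Mt n) =
  \sum_(B <- fpowerset [fset z in zs]%fset) w B * (\prod_(z <- B) a z *
    series (fun n => (n ^_ #|` B|)%:R * rho n * q ^+ (n - #|` B|)) N).
  under eq_bigr do rewrite Upsilon0_mass_normalized.
  rewrite exchange_big /=; apply: eq_bigr => B _.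
  rewrite /series /= !mulr_sumr; apply: eq_bigr => n _.
  by rewrite szA /w; ring.
apply: (@cvg_eq_seq _ _ _ _ _ (fun N => esym (E N))).
rewrite [X in _ --> X](_ : _ = \sum_(B <- fpowerset [fset z in zs]%fset)
    w B * (\prod_(z <- B) a z * card_pgf (deriv_coef rho #|` B|) q)).
  rewrite [X in X @ _ --> _](_ : _ = \sum_(B <- fpowerset [fset z in zs]%fset)
      (fun N => w B * (\prod_(z <- B) a z *
    series (fun n => (n ^_ #|` B|)%:R * rho n * q ^+ (n - #|` B|)) N))).
    elim/big_ind2 : _ => [|f x g y fx gy|B _]; first exact: cvg_cst.
      exact: cvgD.
    by apply: cvgM; [exact: cvg_cst|exact: cvg_ffact_series_density].
  by apply/funext => N; rewrite fct_sumE.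
apply: eq_bigr => B _; rewrite card_pgf0 deriv_coefE !add0n ffactnn /w.
by ring.
Qed.
End upsilon.

(** * Almost everywhere uniqueness *)

Section pi_system.
Context {R : realType} {dZ : measure_display} {Z : measurableType dZ}.
Variable lam : {sigma_finite_measure set Z -> \bar R}.
Variable C : nat -> set Z.
Hypothesis genC : @measurable dZ Z = <<s range C >>.

Definition finite_cap (w : seq nat) : set Z := foldr (fun i A => C i `&` A) setT w.

Lemma finite_cap_cat v w : finite_cap (v ++ w) = finite_cap v `&` finite_cap w.
Proof. by elim: v => [|i v IH] /=; rewrite ?setTI// IH setIA. Qed.

Lemma measurable_finite_cap w : measurable (finite_cap w).
Proof.
elim: w => //= i w mw; apply: measurableI => //.
by rewrite genC; apply: sub_sigma_algebra; exists i.
Qed.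

Lemma finite_cap_gen : @measurable dZ Z = <<s range finite_cap >>.
Proof.
apply/seteqP; split=> A.
  rewrite genC; apply: smallest_sub; first exact: smallest_sigma_algebra.
  move=> _ [i _ <-]; apply: sub_sigma_algebra.
  by exists [:: i] => //=; rewrite setIT.
apply: smallest_sub; first exact: sigma_algebra_measurable.
by move=> _ [w _ <-]; exact: measurable_finite_cap.
Qed.

(** The sets on which f and g have the same integral form a Dynkin system: it
contains the whole space, the empty intersection, and it is closed under
complements and disjoint unions because both functions are integrable. *)
Lemma ae_eq_finite_cap (f g : Z -> R) :
  lam.-integrable setT (EFin \o f) -> lam.-integrable setT (EFin \o g) ->
  (forall w, \int[lam]_(z in finite_cap w) f z = \int[lam]_(z in finite_cap w) g z) ->
  {ae lam, forall z, f z = g z}.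
Proof.
move=> fi gi fg.
have sub (h : Z -> R) B : measurable B -> lam.-integrable setT (EFin \o h) ->
    lam.-integrable B (EFin \o h).
  by move=> mB hi; exact: integrableS hi.
have integral_of_Rintegral B : measurable B ->
    \int[lam]_(z in B) f z = \int[lam]_(z in B) g z ->
    (\int[lam]_(z in B) (f z)%:E = \int[lam]_(z in B) (g z)%:E)%E.
  move=> mB; rewrite /Rintegral => fgB.
  have fin_f := integrable_fin_num mB (sub _ _ mB fi).
  have fin_g := integrable_fin_num mB (sub _ _ mB gi).
  by move/eqP: fgB; rewrite -eqe !fineK// => /eqP.
have int_setC (h : Z -> R) B : measurable B -> lam.-integrable setT (EFin \o h) ->
    \int[lam]_(z in ~` B) h z = \int[lam]_z h z - \int[lam]_(z in B) h z.
  move=> mB hi; rewrite -(setUv B) Rintegral_setU//.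
  - by rewrite addrAC subrr add0r.
  - exact: measurableC.
  - by rewrite setUv.
  - by apply/disj_setPS; rewrite setICr.
have eqI B : measurable B -> \int[lam]_(z in B) f z = \int[lam]_(z in B) g z.
  rewrite {1}finite_cap_gen; move: B; apply: (@dynkin_induction _ _ (range finite_cap)
    (fun B => \int[lam]_(z in B) f z = \int[lam]_(z in B) g z)).
  - exact: finite_cap_gen.
  - move=> _ _ [v _ <-] [w _ <-]; exists (v ++ w) => //; exact: finite_cap_cat.
  - exact: (fg [::]).
  - by move=> _ [w _ <-]; exact: fg.
  - by move=> S mS fgS; rewrite !int_setC// fgS (fg [::]).
  - move=> F mF tF fgF; rewrite /Rintegral; congr fine.
    have mU : measurable (\bigcup_k F k) by exact: bigcupT_measurable.
    rewrite !integral_bigcup//; [|exact: sub..].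
    apply: eq_eseriesr => k _.
    exact: integral_of_Rintegral.
have : ae_eq lam setT (EFin \o f) (EFin \o g).
  apply: integral_ae_eq => //; first by case/integrableP: gi.
  by move=> E _ mE; apply: integral_of_Rintegral => //; exact: eqI.
by apply: filterS => z /= /(_ I) [].
Qed.
End pi_system.

Section uniqueness.
Context {R : realType} {dZ : measure_display} {Z : measurableType dZ}.
Variable lam : {sigma_finite_measure set Z -> \bar R}.

Lemma test_fun_perturb (h : Z -> R) (B : set Z) : test_fun h -> measurable B ->
  \forall n \near \oo, test_fun (fun z => h z + n.+1%:R^-1 * \1_B z).
Proof.
move=> [mh [r r1 hr]] mB.
have e0 : 0 < (1 - r) / 2 by lra.
have := near_infty_natSinv_lt (PosNum e0); apply: filterS => n /= ne.
split; first by apply: measurable_funD => //; exact: measurable_funM.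
exists (r + (1 - r) / 2); first by lra.
move=> z; apply: le_trans (ler_normD _ _) _; apply: lerD => //.
rewrite normrM indicE ger0_norm ?invr_ge0//.
apply: le_trans (ltW ne); rewrite ler_piMr ?invr_ge0//.
by case: (_ \in _); rewrite ?normr1 ?normr0.
Qed.

(** Only the constant sequence of directions 1_B and the steps 1 / (n + 1) are
needed to recover a derivative, hence countably many values of the functional. *)
Lemma chain_derive_unique (F G : (Z -> R) -> R) (h : Z -> R) (B : set Z) d e :
  measurable B -> F h = G h ->
  (\forall n \near \oo, F (fun z => h z + n.+1%:R^-1 * \1_B z) =
                        G (fun z => h z + n.+1%:R^-1 * \1_B z)) ->
  is_chain_derive F h \1_B d -> is_chain_derive G h \1_B e -> d = e.
Proof.
move=> mB FGh FGn dF dG.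
have cvgE H a : is_chain_derive H h \1_B a ->
    (n.+1%:R^-1)^-1 * (H (fun z => h z + n.+1%:R^-1 * \1_B z) - H h)
    @[n --> \oo] --> a.
  move=> dH; apply: (dH (fun n => n.+1%:R^-1) (fun=> \1_B) 1).
  - by move=> n; rewrite invr_eq0.
  - exact: cvg_harmonic.
  - by [].
  - by move=> n z; rewrite indicE; case: (_ \in _); rewrite ?normr1 ?normr0.
  - by move=> z; exact: cvg_cst.
rewrite -(cvg_lim _ (cvgE F d dF))//; apply: cvg_lim => //.
apply: cvg_trans (cvgE G e dG); apply: near_eq_cvg.
by apply: filterS FGn => n FGn; rewrite FGn FGh.
Qed.

Lemma ae_seq_sub k (P Q : seq Z -> Prop) : (forall zs, P zs -> Q zs) ->
  ae_seq lam k P -> ae_seq lam k Q.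
Proof.
elim: k P Q => [|k IH] P Q PQ /=; first exact: PQ.
by apply: filterS => z; apply: IH => zs; exact: PQ.
Qed.

Variable C : nat -> set Z.
Hypothesis genC : @measurable dZ Z = <<s range C >>.

(** A countable family that contains 0 and, with h, all h + 1 / (n + 1) 1_A for
A a finite intersection of generators. *)
Definition step_fun (w : seq (nat * seq nat)) : Z -> R :=
  foldr (fun p h z => h z + p.1.+1%:R^-1 * \1_(finite_cap C p.2) z) (fun=> 0) w.

Variables (G : (Z -> R) -> R) (m : nat) (D E : seq Z -> (Z -> R) -> R).
Hypothesis iD : is_iter_dirac_derive lam G m D.
Hypothesis iE : is_iter_dirac_derive lam G m E.

Let agree (zs : seq Z) := forall w, test_fun (step_fun w) ->
  D zs (step_fun w) = E zs (step_fun w).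

(** Consing (n, v) onto w moves step_fun w by 1 / (n + 1) in the direction of the
set indexed by v, so agreement at the step functions determines the derivatives
in these directions, hence the next density outside a null set for each w; there
are countably many w. *)
Let agree_rcons zs : (size zs < m)%N -> agree zs ->
  {ae lam, forall z, agree (rcons zs z)}.
Proof.
move=> szs DE.
have agree_at w : {ae lam, forall z, test_fun (step_fun w) ->
    D (rcons zs z) (step_fun w) = E (rcons zs z) (step_fun w)}.
  have [th|nth] := pselect (test_fun (step_fun w)); last by apply: aeW => z /nth.
  have [intD dD] := iD.2 zs _ szs th; have [intE dE] := iE.2 zs _ szs th.
  apply: filterS (ae_eq_finite_cap genC intD intE _) => [z + _ //|v].
  have mv := measurable_finite_cap genC v.
  apply: (chain_derive_unique mv _ _ (dD _ mv) (dE _ mv)); first exact: DE.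
  apply: filterS (test_fun_perturb th mv) => n tn.
  exact: (DE ((n, v) :: w)).
have : {ae lam, forall z, forall n w, choice.unpickle n = Some w ->
    test_fun (step_fun w) ->
    D (rcons zs z) (step_fun w) = E (rcons zs z) (step_fun w)}.
  apply: ae_foralln => n; case: (choice.unpickle n) => [w|]; last by apply: aeW.
  by apply: filterS (agree_at w) => z aw _ [<-].
apply: filterS => z H w; exact: (H (choice.pickle w) w (choice.pickleK w)).
Qed.

(** Agreement at all admissible step functions, and not just at 0, is what the
induction on the number of derivatives propagates. *)
Lemma iter_dirac_derive_ae_unique :
  ae_seq lam m (fun zs => D zs (fun=> 0) = E zs (fun=> 0)).
Proof.
have H k ws : (size ws + k = m)%N -> agree ws ->
    ae_seq lam k (fun zs => agree (ws ++ zs)).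
  elim: k ws => [|k IH] ws /= sz aw; first by rewrite cats0.
  have := agree_rcons _ aw; rewrite -sz -addSnnS leq_addr => /(_ isT).
  apply: filterS => z az; have := IH (rcons ws z).
  rewrite size_rcons addSnnS => /(_ sz az).
  by apply: ae_seq_sub => zs; rewrite cat_rcons.
have := H m [::]; rewrite add0n => /(_ erefl) /=.
have t0 : @test_fun R _ Z (fun=> 0).
  by split=> //; exists 0 => // z; rewrite normr0.
have a0 : agree [::] by move=> w tw; rewrite iD.1// iE.1.
move=> /(_ a0); apply: ae_seq_sub => zs /(_ [::]); exact.
Qed.
End uniqueness.

(** * The multi-object likelihood *)

Section intensities.
Context {R : realType}.

Lemma card_mean_ge0 (rho : nat -> R) : is_card_distr rho -> (0 <= card_mean rho)%E.
Proof. by move=> [rho0 _]; apply: nneseries_ge0 => n _ _; rewrite lee_fin mulr_ge0. Qed.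

(** Each term n rho(n) is at most the whole sum. *)
Lemma card_mean_eq0 (rho : nat -> R) : is_card_distr rho -> card_mean rho = 0%E ->
  forall n, (0 < n)%N -> rho n = 0.
Proof.
move=> [rho0 _] m0 n n0.
have t0 k : (0 <= (k%:R * rho k)%:E)%E by rewrite lee_fin mulr_ge0.
have : ((n%:R * rho n)%:E <= 0)%E.
  rewrite -m0 /card_mean; apply: le_trans (nneseries_lim_ge n.+1 _); last by [].
  by rewrite big_nat_recr//= leeDr// sume_ge0.
rewrite lee_fin pmulr_rle0 ?ltr0n// => rn.
by apply/eqP; rewrite eq_le rn rho0.
Qed.

Context {dX : measure_display} {X : measurableType dX}.

(** Holds also when the integral of f is infinite, both sides being 0 then. *)
Lemma Rintegral_intensity (P : probability X R) (nu : {finite_measure set X -> \bar R})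
    (M : R) (f : X -> R) :
  (forall A, measurable A -> nu A = M%:E * P A)%E -> 0 <= M ->
  measurable_fun setT f -> (forall x, 0 <= f x) ->
  \int[nu]_x f x = M * \int[P]_x f x.
Proof.
move=> nuE M0 mf f0; rewrite /Rintegral.
rewrite (@eq_measure_integral _ _ _ _ (mscale (NngNum M0) P) nu)//; last first.
  by move=> A mA _; exact: nuE.
rewrite ge0_integral_mscale//; last 2 first.
  exact/measurable_EFinP.
  by move=> x _; rewrite lee_fin.
have : (0 <= \int[P]_x (f x)%:E)%E by apply: integral_ge0 => x _; rewrite lee_fin.
case: (\int[P]_x _)%E => [r| |] //= _.
by have [->|M0'] := eqVneq M 0; rewrite ?mul0e ?mul0r// gt0_muley ?mulr0//
  lte_fin lt_neqAle eq_sym M0' M0.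
Qed.

(** Since g is real-valued, an infinite k would force the density f to vanish
everywhere, against its integral being 1. *)
Lemma density_factor_fin_num {dZ : measure_display} {Z : measurableType dZ}
    (lam : {measure set Z -> \bar R}) (k : \bar R) (f g : Z -> R) :
  (0 <= k)%E -> (forall z, 0 <= f z) -> (\int[lam]_z (f z)%:E = 1)%E ->
  (forall z, (g z)%:E = (k * (f z)%:E)%E) -> k \is a fin_num.
Proof.
move=> k0 f0 f1 gE; rewrite ge0_fin_numE// ltNge leye_eq; apply/eqP => koo.
have fz z : f z = 0.
  have := gE z; rewrite koo; have := f0 z; rewrite le_eqVlt => /predU1P[//|fz].
  by rewrite gt0_mulye.
move: f1; under eq_integral do rewrite fz.
by rewrite integral0 => /esym/eqP; rewrite onee_eq0.
Qed.
End intensities.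

Theorem mainTheorem2 (R : realType) (dX dZ : measure_display)
  (X : measurableType dX) (Z : measurableType dZ) (S : Type)
  (lam : {sigma_finite_measure set Z -> \bar R})
  (pd : X -> S -> R) (ell : Z -> X -> S -> R)
  (ssharp : S -> probability X R) (mu : S -> {finite_measure set X -> \bar R})
  (sc : Z -> S -> R) (muc : Z -> R) (rho rho_c : nat -> R) (s : S)
  (pd_meas : measurable_fun setT (fun x => pd x s))
  (pd_prob : forall x, 0 <= pd x s <= 1)
  (ell_meas : measurable_fun setT (fun zx : Z * X => ell zx.1 zx.2 s))
  (ell_ge0 : forall z x, 0 <= ell z x s)
  (ell_density : forall x, (\int[lam]_z (ell z x s)%:E = 1)%E)
  (sc_meas : measurable_fun setT (fun z => sc z s))
  (sc_ge0 : forall z, 0 <= sc z s)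
  (sc_density : (\int[lam]_z (sc z s)%:E = 1)%E)
  (rho_distr : is_card_distr rho)
  (rho_c_distr : is_card_distr rho_c)
  (mu_intensity : forall A : set X, measurable A ->
     mu s A = (card_mean rho * ssharp s A)%E)
  (muc_intensity : forall z : Z,
     (muc z)%:E = (card_mean rho_c * (sc z s)%:E)%E)
  (m : nat) :
  let G := G_obs lam pd ell sc ssharp rho rho_c s in
  let rho' := mass_normalized rho (fine (mu s setT)) in
  let rho_c' := mass_normalized rho_c (\int[lam]_z muc z) in
  let formula (zs : seq Z) :=
    inner (Upsilon0 pd ell rho_c' muc mu s [fset z in zs]%fset) rho' in
  (exists2 D : seq Z -> (Z -> R) -> R,
     is_iter_dirac_derive lam G m D &
     forall zs : seq Z, size zs = m -> uniq zs ->
       (D zs (fun=> 0))%:E = formula zs) /\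
  (countably_generated Z ->
   forall D : seq Z -> (Z -> R) -> R, is_iter_dirac_derive lam G m D ->
     ae_seq lam m (fun zs => uniq zs -> (D zs (fun=> 0))%:E = formula zs)).
Proof.
move=> G rho' rho_c' formula.
pose P := ssharp s; pose p x := pd x s; pose l z x := ell z x s; pose b z := sc z s.
pose a := detection_density P p l; pose q := missed_prob P p.
have b0 z : 0 <= b z by exact: sc_ge0.
have ib : lam.-integrable setT (EFin \o b).
  apply/integrableP; split; first exact/measurable_EFinP.
  under eq_integral do rewrite gee0_abs ?lee_fin//.
  by rewrite sc_density ltry.
have ia : lam.-integrable setT (EFin \o a) by exact: integrable_detection_density.
have b1 : \int[lam]_z b z = 1 by rewrite /Rintegral sc_density.
have u1 h : test_fun h -> `|q + \int[lam]_z (h z * a z)| < 1 \/ forall z, a z = 0.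
  exact: target_arg_lt1.
have c1 h : test_fun h -> `|\int[lam]_z (h z * b z)| < 1.
  move=> [mh [r r1 hr]]; apply: le_lt_trans r1.
  by rewrite -[leRHS]mulr1 -b1; exact: weighted_integral_le.
pose D := cphd_deriv lam rho rho_c a b q.
have iD : is_iter_dirac_derive lam G m D.
  split=> [h th|zs h _ th]; last exact: cphd_deriv_dirac.
  by rewrite /G /G_obs (target_pgfl_arg P pd_meas pd_prob ell_meas ell_ge0
    ell_density (test_fun_bounded th)).
(* the mean cardinalities are the total masses of the intensities *)
pose Mt := fine (mu s setT); pose Mc := \int[lam]_z muc z.
have rho_mean : card_mean rho = Mt%:E.
  rewrite /Mt fineK ?fin_num_measure// mu_intensity//.
  by rewrite [X in (_ * X)%E](_ : _ = 1%E) ?mule1//; exact: probability_setT.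
have Mt_ge0 : 0 <= Mt by rewrite -lee_fin -rho_mean card_mean_ge0.
have rho_c_fin : card_mean rho_c \is a fin_num.
  exact: (density_factor_fin_num (card_mean_ge0 rho_c_distr) sc_ge0 sc_density).
have mucM z : muc z = fine (card_mean rho_c) * b z.
  by apply: EFin_inj; rewrite EFinM fineK// muc_intensity.
have McE : Mc = fine (card_mean rho_c).
  rewrite /Mc; under eq_Rintegral do rewrite mucM.
  by rewrite RintegralZl// b1 mulr1.
have rho_c_mean : card_mean rho_c = Mc%:E by rewrite McE fineK.
have mucE z : muc z = Mc * b z by rewrite McE.
have DE zs : uniq zs -> (D zs (fun=> 0))%:E = formula zs.
  move=> uzs; apply: cphd_deriv0E => //.
  - rewrite /missed_detection (@Rintegral_intensity _ _ _ P (mu s) Mt)//.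
    + by move=> A mA; rewrite -rho_mean; exact: mu_intensity.
    + exact: measurable_funB.
    + by move=> x; rewrite subr_ge0; case/andP: (pd_prob x).
  - move=> z; rewrite /association (@Rintegral_intensity _ _ _ P (mu s) Mt)//.
    + by move=> A mA; rewrite -rho_mean; exact: mu_intensity.
    + apply: measurable_funM => //; exact: measurable_fun_pair2 ell_meas.
    + by move=> x; rewrite mulr_ge0//; case/andP: (pd_prob x).
  - by move=> Mt0; apply: card_mean_eq0 => //; rewrite rho_mean; exact: congr1 Mt0.
  - by move=> Mc0; apply: card_mean_eq0 => //; rewrite rho_c_mean; exact: congr1 Mc0.
  - exact: missed_prob_ge0.
  - have [q1|q1] := eqVneq q 1.
      by right; split=> // z; exact: detection_density_eq0.
    by left; rewrite lt_neqAle q1; exact: missed_prob_le1.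
split; first by exists D => // zs _; exact: DE.
move=> [C genC] D' iD'.
apply: ae_seq_sub (iter_dirac_derive_ae_unique genC iD' iD) => zs -> ; exact: DE.
Qed.
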